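(* Let $X$ and $Y$ be nonnegative absolutely continuous random variables with bounded supports and distribution functions $F$ and $G$, respectively. Let $\{n_j\}_{j\ge1}$ be a strictly increasing sequence of positive integers with $\sum_{j=1}^\infty n_j^{-1}=+\infty$. Then $F$ and $G$ belong to the same family of distributions but for a change in location (i.e. there is a constant $d\in\mathbb{R}$ with $F^{-1}(v)=G^{-1}(v)+d$ for all $0<v<1$) if and only if $$\overline\varepsilon J(X_{n:n})=\overline\varepsilon J(Y_{n:n})\quad\text{for all } n=n_j,\ j\ge1.$$
   Context: For a nonnegative random variable $X$ with cdf $F$ whose support has finite right endpoint $b_X$, $X_{n:n}$ denotes the maximum of $n$ i.i.d. copies of $X$ (with cdf $F^n$). The cumulative past extropy (CPEx) of $X_{n:n}$ is $$\overline\varepsilon J(X_{n:n})=-\frac12\int_0^{b_X}F^{2n}(x)\,dx;$$ similarly for $Y$ with $G$ and $b_Y$. $F^{-1}(v)=\inf\{x:F(x)\ge v\}$ is the quantile function. *)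

(* Defs.v *)
From HB Require Import structures.
From mathcomp Require Import all_boot all_order all_algebra.
From mathcomp Require Import all_classical all_reals all_analysis.

Set Implicit Arguments.
Unset Strict Implicit.
Unset Printing Implicit Defensive.

Import Order.TTheory GRing.Theory Num.Theory.
Import numFieldNormedType.Exports.

Local Open Scope classical_set_scope.
Local Open Scope ring_scope.

(* [cdf X] is extended-real valued; its values lie in [0, 1]. *)
Definition rcdf d (T : measurableType d) (R : realType) (P : probability T R)
  (X : {RV P >-> R}) (x : R) : R := fine (cdf X x).

(* The topological support of the law of X. *)
Definition rv_support d (T : measurableType d) (R : realType)
    (P : probability T R) (X : {RV P >-> R}) : set R :=
  [set x | forall e : R, 0 < e -> (0 < distribution P X (ball x e))%E].

(* A real number only when the support of X is bounded above; [sup] is 0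
   otherwise. *)
Definition right_endpoint d (T : measurableType d) (R : realType)
  (P : probability T R) (X : {RV P >-> R}) : R := sup (rv_support X).

Definition quantile d (T : measurableType d) (R : realType)
    (P : probability T R) (X : {RV P >-> R}) (v : R) : R :=
  inf [set x | v <= rcdf X x].

(* The cumulative past extropy of the maximum X_{n:n} of n i.i.d. copies of X,
   expressed, as X_{n:n} has cdf F^n and the same right endpoint as X, by means
   of the cdf F of X. *)
Definition cpex_max d (T : measurableType d) (R : realType)
    (P : probability T R) (X : {RV P >-> R}) (n : nat) : R :=
  - (1 / 2) * \int[lebesgue_measure]_(x in `[0, right_endpoint X])
                (rcdf X x ^+ (2 * n)).

(* Main.v *)
Require Import Defs.
From HB Require Import structures.
From mathcomp Require Import all_boot all_order all_algebra.
From mathcomp Require Import ring lra.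
From mathcomp Require Import all_classical all_reals all_analysis.
From mathcomp Require Import measurable_realfun.

(* Write b for the right endpoint and I(p) for the integral of p(F) over [0, b].
   A shift of the quantile function shifts F and b, whence one implication.
   Conversely, the functional Lambda(p) = I_X(p) - I_Y(p) on polynomials is
   bounded for the sup norm on [0, 1] and kills x^(2 n_j) for all j.  By
   von Golitschek's proof of Muntz's theorem, each x^q with q > 0 is a uniform
   limit of combinations of the x^(2 n_j), so Lambda(p) = 0 whenever p(0) = 0.
   Polynomials close to the indicator function of [v, 1] then show that
   {F >= v} and {G >= v}, in [0, b_X] and [0, b_Y], have the same length:
   b_X - F^-1(v) = b_Y - G^-1(v). *)

Set Implicit Arguments.
Unset Strict Implicit.
Unset Printing Implicit Defensive.

Import Order.TTheory GRing.Theory Num.Theory.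
Import numFieldNormedType.Exports.

Local Open Scope classical_set_scope.
Local Open Scope ring_scope.

(** * Muntz approximation of monomials in the sup norm on [0, 1] *)

(* Maximum principle: at an interior extremum of [S] the Euler equation reads
   [l S = c Q]. *)
Lemma horner_le_euler (R : realType) (S Q : {poly R}) (l c M : R) :
  0 < l -> S.[0] = 0 -> S.[1] = 0 -> l *: S - 'X * S^`() = c *: Q ->
  (forall x, 0 <= x <= 1 -> `|Q.[x]| <= M) ->
  forall x, 0 <= x <= 1 -> S.[x] <= `|c| / l * M.
Proof.
move=> l0 S0 S1 SQ QM x x01.
have M0 : 0 <= M by rewrite (le_trans (normr_ge0 _) (QM x x01)).
have [|z] := @EVT_max R (horner S) 0 1 ler01.
  by apply: continuous_subspaceT; exact: continuous_horner.
rewrite in_itv/= => z01 Smax.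
have {}Smax y : 0 <= y <= 1 -> S.[y] <= S.[z].
  by move=> y01; apply: Smax; rewrite in_itv.
apply: le_trans (Smax x x01) _.
have B0 : 0 <= `|c| / l * M by rewrite mulr_ge0// divr_ge0// ltW.
have [->|z0] := eqVneq z 0; first by rewrite S0.
have [->|z1] := eqVneq z 1; first by rewrite S1.
have zI : z \in `]0, 1[%R.
  by rewrite in_itv/= !lt_neqAle z1 eq_sym z0.
have S'z : S^`().[z] = 0.
  have zmax : is_derive z 1 (horner S) 0.
    apply: (@derive1_at_max _ _ 0 1) => //= t.
    by rewrite in_itv/= => /andP[t0 t1]; apply: Smax; rewrite !ltW.
  by rewrite derivE derive1E derive_val.
have := congr1 (fun p => p.[z]) SQ.
rewrite !hornerE S'z mulr0 subr0 => lSz.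
rewrite mulrAC ler_pdivlMr// mulrC lSz.
by rewrite (le_trans (ler_norm _))// normrM ler_wpM2l// QM.
Qed.

Lemma normr_horner_le_euler (R : realType) (S Q : {poly R}) (l c M : R) :
  0 < l -> S.[0] = 0 -> S.[1] = 0 -> l *: S - 'X * S^`() = c *: Q ->
  (forall x, 0 <= x <= 1 -> `|Q.[x]| <= M) ->
  forall x, 0 <= x <= 1 -> `|S.[x]| <= `|c| / l * M.
Proof.
move=> l0 S0 S1 SQ QM x x01; rewrite ler_norml; apply/andP; split; last first.
  exact: horner_le_euler SQ QM _ x01.
rewrite lerNl -hornerN; apply: (@horner_le_euler _ (- S) (- Q)) x01 => //.
- by rewrite hornerN S0 oppr0.
- by rewrite hornerN S1 oppr0.
- by rewrite derivN mulrN !scalerN -opprD SQ.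
- by move=> y y01; rewrite hornerN normrN QM.
Qed.

(* Induction on [k]: the linear map sending ['X^m] to
   [(l k - q) / (l k - m) *: ('X^m - 'X^(l k))] fixes the coefficient of ['X^q],
   and by the previous lemma it multiplies the sup norm by at most
   [1 - q / l k]. *)
Lemma muntz_approx (R : realType) (q : nat) (l : nat -> nat) (k : nat) :
  (0 < q)%N -> (forall j, (q < l j)%N) -> injective l ->
  exists a : nat -> R, forall x, 0 <= x <= 1 ->
    `|('X^q - \sum_(j < k) a j *: 'X^(l j)).[x]| <=
    \prod_(j < k) (1 - q%:R / (l j)%:R).
Proof.
move=> q0 ql linj; elim: k => [|k [a ak]].
  exists (fun=> 0) => x /andP[x0 x1]; rewrite !big_ord0 subr0 hornerXn.
  by rewrite ger0_norm ?exprn_ge0// exprn_ile1.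
pose L := (l k)%:R : R.
(* The linear map sends ['X^q - \sum_j a j *: 'X^(l j)] to ['X^q - 'X^(l k) - \sum_j c j *: ('X^(l
   j) - 'X^(l k))]. In [a'], the new exponent [l k] collects the coefficient [1 - \sum_j c j]. *)
pose c (j : nat) : R := (L - q%:R) / (L - (l j)%:R) * a j.
pose a' j := if j == k then 1 - \sum_(i < k) c i else c j.
exists a' => x x01.
have lpos j : (0 < l j)%N by rewrite (leq_trans _ (ql j)).
have L0 : 0 < L by rewrite ltr0n.
have -> : \sum_(j < k.+1) a' j *: 'X^(l j) =
          'X^(l k) + \sum_(j < k) c j *: ('X^(l j) - 'X^(l k)) :> {poly R}.
  rewrite big_ord_recr/= {2}/a' eqxx.
  under eq_bigr do rewrite /a' ltn_eqF//.
  under [in RHS]eq_bigr do rewrite scalerBr.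
  by rewrite sumrB -scaler_suml scalerBl scale1r addrCA.
rewrite big_ord_recr/= mulrC.
have -> : 1 - q%:R / (l k)%:R = `|L - q%:R| / L.
  rewrite ger0_norm ?subr_ge0 ?ler_nat ?(ltnW (ql k))//.
  by rewrite mulrBl divff// gt_eqF.
apply: normr_horner_le_euler ak x x01 => //.
- rewrite !hornerE !horner_sum big1 ?addr0 => [|j _]; first last.
    by rewrite !hornerE !expr0n !gtn_eqF ?lpos//= subrr mulr0.
  by rewrite !expr0n !gtn_eqF// subrr.
- rewrite !hornerE !horner_sum big1 ?addr0 => [|j _]; first last.
    by rewrite !hornerE !expr1n subrr mulr0.
  by rewrite !expr1n subrr.
(* The Euler operator [D] is diagonal on monomials, with eigenvalue [L - m] at ['X^m]. It kills
   ['X^(l k)] and cancels the denominators [L - l j] of [c]. *)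
- pose D (p : {poly R}) := L *: p - 'X * p^`().
  have DD : {morph D : x y / x + y}.
    by move=> x' y'; rewrite /D derivD scalerDr mulrDr opprD addrACA.
  have DZ b p : D (b *: p) = b *: D p.
    by rewrite /D derivZ -scalerAr scalerBr !scalerA mulrC.
  have DB x' y' : D (x' - y') = D x' - D y'.
    by rewrite DD -(scaleN1r y') DZ scaleN1r.
  have D0 : D 0 = 0 by rewrite /D deriv0 mulr0 scaler0 subr0.
  have DX m : (0 < m)%N -> D 'X^m = (L - m%:R) *: 'X^m.
    case: m => // m _; rewrite /D derivXn /= mulrnAr -exprS.
    by rewrite -[_ *+ _]scaler_nat -scalerBl.
  have DS : D (\sum_(j < k) c j *: ('X^(l j) - 'X^(l k))) =
      (L - q%:R) *: \sum_(j < k) a j *: 'X^(l j).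
    rewrite (big_morph D DD D0).
    rewrite scaler_sumr; apply: eq_bigr => j _.
    rewrite DZ DB !DX// /L subrr scale0r subr0 !scalerA /c mulrAC divfK//.
    rewrite subr_eq0 eqr_nat; apply/eqP => /linj kj.
    by have := ltn_ord j; rewrite -kj ltnn.
  by rewrite -/(D _) DB DD DS !DX// /L subrr scale0r add0r scalerBr.
Qed.

(** Induction from [(1 - u) * (1 + s + u) <= 1 + s] for [s, u >= 0]. Divergence of the sum thus
    forces the product to 0, without logarithms or exponentials. *)
Lemma prod_onem_le (R : realFieldType) (u : nat -> R) (k : nat) :
  (forall j, 0 <= u j <= 1) ->
  \prod_(j < k) (1 - u j) <= (1 + \sum_(j < k) u j)^-1.
Proof.
move=> u01; elim: k => [|k ih]; first by rewrite !big_ord0 addr0 invr1.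
rewrite !big_ord_recr/=; set s := \sum_(j < k) u j in ih *.
have s0 : 0 <= s by apply: sumr_ge0 => j _; case/andP: (u01 j).
have /andP[u0 u1] := u01 k.
have := ler_wpM2r (_ : 0 <= 1 - u k) ih.
rewrite subr_ge0 => /(_ u1) /le_trans; apply.
rewrite ler_pdivrMl ?ltr_pwDl// ler_pdivlMr; first by nra.
by rewrite addrA ltr_wpDr// ltr_pwDl.
Qed.

(** Applied to the error in [muntz_approx], [phi] leaves only [phi 'X^q], so
    [|phi 'X^q| * (1 + \sum_j q / l j) <= C] over exponents above [q]. A nonzero value would bound
    the divergent series. *)
Lemma muntz_functional (R : realType) (phi : {scalar {poly R}}) (C : R)
  (l : nat -> nat) :
  (forall (p : {poly R}) (M : R),
    (forall x, 0 <= x <= 1 -> `|p.[x]| <= M) -> `|phi p| <= C * M) ->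
  (forall i j, (i < j)%N -> (l i < l j)%N) ->
  series (fun j => (l j)%:R^-1 : R) @ \oo --> +oo ->
  (forall j, phi 'X^(l j) = 0) ->
  forall q, (0 < q)%N -> phi 'X^q = 0.
Proof.
move=> phiC lincr ldiv phil q q0; apply/eqP/negPn/negP => phiq.
have {phiq} phiq : 0 < `|phi 'X^q| by rewrite normr_gt0.
have lge j : (j <= l j)%N.
  by elim: j => // j /leq_ltn_trans; apply; exact: lincr.
(* Since [j <= l j], dropping the first [q.+1] terms leaves only exponents above [q], as
   [muntz_approx] requires. *)
pose l' j := l (q.+1 + j)%N.
have ql' j : (q < l' j)%N by rewrite (leq_trans _ (lge _))// leq_addr.
have l'inj : injective l'.
  move=> i j; case: (ltngtP i j) => // ij /eqP.
    by rewrite ltn_eqF// lincr// ltn_add2l.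
  by rewrite gtn_eqF// lincr// ltn_add2l.
have bounded k : \sum_(j < k) q%:R / (l' j)%:R <= C / `|phi 'X^q| :> R.
  have [a ak] := @muntz_approx R q l' k q0 ql' l'inj.
  have := phiC _ _ ak; rewrite linearB linear_sum big1 => [|j _]; last first.
    by rewrite linearZ /= phil mulr0.
  have C0 : 0 <= C.
    have := phiC 0 1; rewrite linear0 normr0 mulr1; apply=> x _.
    by rewrite horner0 normr0.
  rewrite subr0 => phiP.
  have u01 j : 0 <= (q%:R / (l' j)%:R : R) <= 1.
    rewrite divr_ge0//= ler_pdivrMr ?mul1r ?ler_nat ?(ltnW (ql' j))//.
    by rewrite ltr0n (leq_trans _ (ql' j)).
  have := le_trans phiP (ler_wpM2l C0 (@prod_onem_le R _ k u01)).
  set s := \sum_(j < k) _.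
  have s0 : 0 <= s by apply: sumr_ge0 => j _; case/andP: (u01 j).
  rewrite ler_pdivlMr ?ltr_pwDl// => H; rewrite ler_pdivlMr//.
  by apply: le_trans H; rewrite mulrDr mulr1 mulrC lerDr.
(* The dropped terms, plus the bound on the remaining ones, plus 1 to make the contradiction strict.
   As [1 <= q], [bounded] also bounds the sums of [1 / l' j]. *)
pose B := series (fun j => (l j)%:R^-1 : R) q.+1 + C / `|phi 'X^q| + 1.
have /cvgryPge/(_ B)[N _ NB] := ldiv.
have := NB (q.+1 + N)%N (leq_addl _ _).
have q1 : 1 <= q%:R :> R by rewrite ler1n.
rewrite /B /series/= -addrA big_mkord big_mkord big_split_ord/= lerD2l.
apply/negP; rewrite -ltNge ltr_pwDr// (le_trans _ (bounded N))//.
by apply: ler_sum => j _; rewrite ler_peMl.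
Qed.

(** * Polynomials close to a step function *)

(** The left bound, Bernoulli's inequality, is of use when [n * y] is small, and the right one when
    [n * y] is large: these are the two sides of the step. *)
Lemma ler_expr_onem (R : realFieldType) (y : R) (n : nat) :
  0 <= y <= 1 -> 1 - n%:R * y <= (1 - y) ^+ n <= (1 + n%:R * y)^-1.
Proof.
move=> /andP[y0 y1]; apply/andP; split.
  elim: n => [|n ih]; first by rewrite mul0r subr0.
  rewrite exprSr; apply: le_trans (ler_wpM2r (_ : 0 <= 1 - y) ih); last by lra.
  have : 0 <= n%:R * y ^+ 2 by rewrite mulr_ge0// exprn_ge0.
  rewrite -natr1; nra.
have := @prod_onem_le R (fun=> y) n (fun=> introT andP (conj y0 y1)).
by rewrite prodr_const sumr_const card_ord mulr_natl.
Qed.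

Lemma exists_expr_lt (R : realType) (x y e : R) :
  0 <= x < 1 -> 0 <= y < 1 -> 0 < e -> exists n, x ^+ n < e /\ y ^+ n < e.
Proof.
move=> /andP[x0 x1] /andP[y0 y1] e0.
have small z : 0 <= z -> z < 1 -> \forall n \near \oo, z ^+ n < e.
  move=> z0 z1; apply: cvgr_lt e0; apply: cvg_expr; by rewrite ger0_norm.
have [N _ HN] := filterI (small x x0 x1) (small y y0 y1).
by exists N; apply: HN => /=.
Qed.

(** Once [(u / v)^a < 1/2], the interval from [v^-a] to [u^-a] starts at 1 or above and has end
    ratio above 2, so it contains the integer [floor(v^-a) + 1], which is at most [2 * v^-a]. *)
Lemma exists_threshold (R : realType) (u v : R) :
  0 < u -> u < v -> v <= 1 ->
  exists a K : nat, [/\ (0 < a)%N, K%:R * u ^+ a < 1 & 1 < K%:R * v ^+ a].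
Proof.
move=> u0 uv v1; have v0 := lt_trans u0 uv.
have uv01 : 0 <= u / v < 1 by rewrite divr_ge0 ?ltW//= ltr_pdivrMr// mul1r.
have [|a [ua _]] := @exists_expr_lt R (u / v) (u / v) 2^-1 uv01 uv01 _.
  by rewrite invr_gt0.
have a0 : (0 < a)%N.
  by case: a ua => //; rewrite expr0; lra.
have va0 : 0 < v ^+ a by rewrite exprn_gt0.
have va1 : v ^+ a <= 1 by rewrite exprn_ile1// ltW.
rewrite expr_div_n ltr_pdivrMr// in ua.
have /truncn_itv/andP[K1 K2] : 0 <= (v ^+ a)^-1 by rewrite invr_ge0 ltW.
exists a, (Num.truncn (v ^+ a)^-1).+1; split => //; last first.
  by rewrite -ltr_pdivrMr// mul1r.
have : (Num.truncn (v ^+ a)^-1).+1%:R <= 2 * (v ^+ a)^-1.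
  rewrite -natr1 mulr_natl mulr2n lerD// invf_ge1//.
move=> /(ler_wpM2r (ltW (exprn_gt0 a u0))) /le_lt_trans; apply.
by rewrite -mulrA mulrCA mulrC ltr_pdivrMr// mul1r -ltr_pdivlMl// mulrC.
Qed.

(* [1 - (1 - x^(a m))^(K^m)] tends, as [m] grows, to the indicator function of
   [x > K^(-1/a)]; [a] and [K] put this threshold between [u] and [v]. *)
Lemma exists_step_poly (R : realType) (u v e : R) :
  0 < u -> u < v -> v <= 1 -> 0 < e ->
  exists p : {poly R}, [/\ p.[0] = 0,
    forall x, 0 <= x <= 1 -> 0 <= p.[x] <= 1,
    forall x, 0 <= x <= u -> p.[x] <= e &
    forall x, v <= x <= 1 -> 1 - e <= p.[x]].
Proof.
move=> u0 uv v1 e0; have v0 := lt_trans u0 uv.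
have [a [K [a0 Ku Kv]]] := @exists_threshold R u v u0 uv v1.
have Kv0 := lt_trans ltr01 Kv.
have [||m [mu mv]] :=
  @exists_expr_lt R (K%:R * u ^+ a) (K%:R * v ^+ a)^-1 e _ _ e0.
- by rewrite Ku mulr_ge0 ?exprn_ge0// ltW.
- by rewrite invf_lt1// Kv invr_ge0 ltW.
have m0 : (0 < a * m.+1)%N by rewrite muln_gt0 a0.
pose y (x : R) := x ^+ (a * m.+1).
have y01 x : 0 <= x <= 1 -> 0 <= y x <= 1.
  by case/andP=> x0 x1; rewrite exprn_ge0//= exprn_ile1.
(* The exponents are matched so that [K^(m+1) * y x = (K * x^a)^(m+1)], a power of a number below 1
   for [x <= u] and above 1 for [x >= v]. Taking [m.+1] keeps the degree of [y] positive, whence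
   [p.[0] = 0]. *)
pose p : {poly R} := 1 - (1 - 'X^(a * m.+1)) ^+ (K ^ m.+1).
have px x : p.[x] = 1 - (1 - y x) ^+ (K ^ m.+1) by rewrite /p !hornerE.
have Ky z : (K ^ m.+1)%:R * y z = (K%:R * z ^+ a) ^+ m.+1.
  by rewrite /y exprMn exprM natrX.
have Kmono (s t : R) : 0 <= s -> s <= t ->
    (K%:R * s ^+ a) ^+ m.+1 <= (K%:R * t ^+ a) ^+ m.+1.
  move=> s0 st; have t0 := le_trans s0 st.
  by apply: lerXn2r; rewrite ?nnegrE ?mulr_ge0 ?exprn_ge0// ler_wpM2l// lerXn2r.
exists p; split => [|x /[dup] x01 /y01 /andP[y0 y1]|x /andP[x0 xu]|
  x /andP[vx x1]].
- by rewrite px /y expr0n gtn_eqF// subr0 expr1n subrr.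
- rewrite px; have : 0 <= (1 - y x) ^+ (K ^ m.+1) <= 1.
    by rewrite exprn_ge0 ?exprn_ile1//=; lra.
  lra.
- have x01 : 0 <= x <= 1 by lra.
  rewrite px; have /andP[+ _] := @ler_expr_onem R _ (K ^ m.+1) (y01 _ x01).
  rewrite Ky => H.
  have := Kmono x u x0 xu.
  have : (K%:R * u ^+ a) ^+ m.+1 <= (K%:R * u ^+ a) ^+ m.
    rewrite exprS ler_piMl ?exprn_ge0 ?mulr_ge0 ?exprn_ge0// ltW//.
  lra.
- have x01 : 0 <= x <= 1 by lra.
  rewrite px lerB//.
  have /andP[_ +] := @ler_expr_onem R _ (K ^ m.+1) (y01 _ x01).
  move=> /le_trans; apply; apply: le_trans (ltW mv).
  rewrite exprVn lef_pV2 ?posrE ?exprn_gt0//; last first.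
    by rewrite ltr_pwDl// mulr_ge0//; case/andP: (y01 _ x01).
  rewrite Ky; apply: (@le_trans _ _ ((K%:R * v ^+ a) ^+ m.+1)).
    by rewrite exprS ler_peMl ?exprn_ge0// ltW.
  apply: (@le_trans _ _ ((K%:R * x ^+ a) ^+ m.+1)); last by rewrite lerDr.
  exact: Kmono (ltW v0) vx.
Qed.

(** * Integrals of polynomials in a distribution function *)

(** Monotonicity makes [p.[F x]] measurable and the range makes it bounded, hence integrable on
    bounded intervals. *)
Definition cdf_like (R : realType) (F : R -> R) :=
  nondecreasing_fun F /\ forall x, 0 <= F x <= 1.

Definition integral_horner (R : realType) (F : R -> R) (b : R)
    (p : {poly R}) : R :=
  \int[lebesgue_measure]_(x in `[0, b]) p.[F x].

Lemma horner_bounded01 (R : realFieldType) (p : {poly R}) :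
  exists M, forall x, 0 <= x <= 1 -> `|p.[x]| <= M.
Proof.
elim/poly_ind: p => [|p c [M pM]].
  by exists 0 => x; rewrite horner0 normr0.
exists (M + `|c|) => x x01; rewrite hornerMXaddC (le_trans (ler_normD _ _))//.
rewrite lerD2r normrM; have := pM x x01; have /andP[x0 x1] := x01.
by rewrite (ger0_norm x0); apply: le_trans; rewrite ler_piMr.
Qed.

Lemma integrable_horner (R : realType) (F : R -> R) (A : set R) (p : {poly R}) :
  cdf_like F -> measurable A -> (lebesgue_measure A < +oo)%E ->
  lebesgue_measure.-integrable A (EFin \o (fun x => p.[F x])).
Proof.
move=> [ndF F01] mA Aoo; apply: measurable_bounded_integrable => //.
  apply: (@measurableT_comp _ _ _ _ _ _ (horner p)).
    by apply: continuous_measurable_fun; exact: continuous_horner.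
  exact: nondecreasing_measurable.
have [M pM] := horner_bounded01 p.
exists M; split; first exact: num_real.
by move=> K MK x _ /=; rewrite (le_trans (pM _ (F01 x)))// ltW.
Qed.

Lemma lebesgue_measure_itv_lty (R : realType) (b0 b1 : bool) (a b : R) :
  (lebesgue_measure [set` Interval (BSide b0 a) (BSide b1 b)] < +oo)%E.
Proof.
by rewrite lebesgue_measure_itv/=; case: ifPn => // _; rewrite -EFinB ltry.
Qed.

Lemma fine_lebesgue_measure_itv (R : realType) (b0 b1 : bool) (a b : R) :
  a <= b ->
  fine (lebesgue_measure [set` Interval (BSide b0 a) (BSide b1 b)]) = b - a.
Proof.
rewrite lebesgue_measure_itv/= lte_fin le_eqVlt => /predU1P[->|ab].
  by rewrite ltxx subrr.
by rewrite ab.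
Qed.

Section integral_horner_theory.
Context (R : realType) (F : R -> R).
Context (cdfF : cdf_like F).

Let intF (b0 b1 : bool) (a b : R) (p : {poly R}) :
  lebesgue_measure.-integrable [set` Interval (BSide b0 a) (BSide b1 b)]
    (EFin \o (fun x => p.[F x])).
Proof. by apply: integrable_horner => //; exact: lebesgue_measure_itv_lty. Qed.

Let intC (b0 b1 : bool) (a b c : R) :
  lebesgue_measure.-integrable [set` Interval (BSide b0 a) (BSide b1 b)]
    (EFin \o (fun=> c)).
Proof.
have := intF b0 b1 a b c%:P; apply: eq_integrable => // x _ /=.
by rewrite hornerC.
Qed.

Lemma integral_horner_scalar b : scalar (integral_horner F b).
Proof.
move=> c p q; rewrite /integral_horner.
under eq_Rintegral do rewrite hornerD hornerZ.
rewrite RintegralD//=; first by rewrite RintegralZl//=; exact: intF.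
have := intF true false 0 b (c *: p); apply: eq_integrable => // x _ /=.
by rewrite hornerZ.
Qed.

Lemma normr_integral_horner b p M : 0 <= b ->
  (forall x, 0 <= x <= 1 -> `|p.[x]| <= M) -> `|integral_horner F b p| <= b * M.
Proof.
move=> b0 pM; rewrite /integral_horner.
apply: le_trans (le_normr_Rintegral _ (intF _ _ _ _ _)) _ => //.
rewrite (_ : b * M = \int[lebesgue_measure]_(x in `[0, b]) M); last first.
  by rewrite Rintegral_cst// fine_lebesgue_measure_itv// subr0 mulrC.
apply: le_Rintegral => //; first exact/integrable_norm/intF.
by move=> x _; apply: pM; case: cdfF.
Qed.

Let splitF b c p : 0 <= c <= b -> integral_horner F b p =
  \int[lebesgue_measure]_(x in `[0, c[) p.[F x] +
  \int[lebesgue_measure]_(x in `[c, b]) p.[F x].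
Proof.
move=> /andP[c0 cb]; rewrite Rintegral_itv_bndo_bndc ?intF//.
rewrite -(@Rintegral_itv_obnd_cbnd _ c) ?intF//.
rewrite -(@Rintegral_itvB _ _ _ _ c (intF true false 0 b p)) ?bnd_simp//.
by rewrite addrC subrK.
Qed.

Lemma integral_horner_ge b c p w : 0 <= c <= b ->
  (forall x, 0 <= x <= 1 -> 0 <= p.[x]) -> (forall x, c <= x -> w <= p.[F x]) ->
  w * (b - c) <= integral_horner F b p.
Proof.
move=> /[dup] c0b /andP[c0 cb] p0 wp; rewrite (splitF _ c0b).
apply: ler_wpDl; first by apply: Rintegral_ge0 => x _; apply: p0; case: cdfF.
rewrite -(fine_lebesgue_measure_itv true false cb) -Rintegral_cst//.
apply: le_Rintegral => //.
by move=> x /=; rewrite in_itv/= => /andP[cx _]; exact: wp.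
Qed.

Lemma integral_horner_le b c p w : 0 <= c <= b ->
  (forall x, 0 <= x <= 1 -> p.[x] <= 1) -> (forall x, x < c -> p.[F x] <= w) ->
  integral_horner F b p <= w * c + (b - c).
Proof.
move=> /[dup] c0b /andP[c0 cb] p1 wp; rewrite (splitF _ c0b); apply: lerD.
  rewrite -[X in _ <= w * X]subr0 -(fine_lebesgue_measure_itv true true c0).
  rewrite -Rintegral_cst//; apply: le_Rintegral => //.
  by move=> x /=; rewrite in_itv/= => /andP[_ xc]; exact: wp.
rewrite -[leRHS]mul1r -(fine_lebesgue_measure_itv true false cb).
rewrite -Rintegral_cst//.
apply: le_Rintegral => //.
by move=> x _; apply: p1; case: cdfF.
Qed.

End integral_horner_theory.

(** Here [cF] stands for the [v]-quantile of [F] and [cG] for the [u]-quantile of [G]. A polynomial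
    step between [u] and [v] has [F]-integral almost at least [bF - cF] and [G]-integral at most
    about [bG - cG]. *)
Lemma level_set_le (R : realType) (F G : R -> R) (bF bG cF cG u v : R) :
  cdf_like F -> cdf_like G ->
  (forall p, p.[0] = 0 -> integral_horner F bF p = integral_horner G bG p) ->
  0 < u -> u < v -> v <= 1 -> 0 <= cF <= bF -> 0 <= cG <= bG ->
  (forall x, cF <= x -> v <= F x) -> (forall x, x < cG -> G x <= u) ->
  bF - cF <= bG - cG.
Proof.
move=> cdfF cdfG FG u0 uv v1 cbF cbG Fv Gu.
pose D := bF - cF; pose E := bG - cG.
have D0 : 0 <= D by rewrite /D; lra.
have cG0 : 0 <= cG by lra.
rewrite -/D -/E; apply/ler_addgt0Pr => e e0.
(* The errors add up to [e' * D + e' * cG], which is below [e]; the 1 keeps the denominator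
   positive. *)
pose e' := e / (cG + D + 1).
have cD0 : 0 < cG + D + 1 by lra.
have e'0 : 0 < e' by rewrite divr_gt0.
have [p [p0 p01 pu pv]] := exists_step_poly u0 uv v1 e'0.
have F01 : forall x, 0 <= F x <= 1 by case: cdfF.
have G01 : forall x, 0 <= G x <= 1 by case: cdfG.
have lo : (1 - e') * D <= integral_horner F bF p.
  apply: (integral_horner_ge cdfF cbF) => [x /p01 /andP[]//|x cx].
  by apply: pv; rewrite (Fv _ cx); case/andP: (F01 x).
have hi : integral_horner G bG p <= e' * cG + E.
  apply: (integral_horner_le cdfG cbG) => [x /p01 /andP[]//|x cx].
  by apply: pu; rewrite (Gu _ cx) andbT; case/andP: (G01 x).
rewrite (FG _ p0) in lo.
have := le_trans lo hi; have : e' * (cG + D + 1) = e by rewrite divfK// gt_eqF.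
nra.
Qed.

(** * Distribution function, support and quantiles of a random variable *)

Section rcdf_theory.
Context (R : realType) (d : measure_display) (T : measurableType d)
  (P : probability T R) (X : {RV P >-> R}).
Local Notation F := (rcdf X).

Lemma rcdfE x : (F x)%:E = cdf X x.
Proof. by rewrite fineK// fin_num_measure. Qed.

Lemma rcdf_cdf_like : cdf_like F.
Proof.
split=> [x y xy|x]; last by rewrite -!lee_fin rcdfE cdf_ge0 cdf_le1.
by rewrite -lee_fin !rcdfE cdf_nondecreasing.
Qed.

Lemma rcdf_le x y : x <= y -> F x <= F y.
Proof. by case: rcdf_cdf_like => + _; apply. Qed.

Lemma rcdf_itvoc x y : x <= y -> F y = F x + fine (distribution P X `]x, y]).
Proof.
move=> xy; rewrite /rcdf /cdf -fineD ?fin_num_measure//; congr fine.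
rewrite -measureU//; last first.
  by apply/seteqP; split=> z //= []; rewrite !in_itv/= => ? /andP[]; lra.
congr (distribution P X _); apply/seteqP; split=> z /=; rewrite !in_itv/=.
  by move=> zy; case: (leP z x) => ?; [left|right].
by case=> [|/andP[]//]; lra.
Qed.

Lemma ler_rcdf_right x v : (forall y, x < y -> v <= F y) -> v <= F x.
Proof.
move=> vF; have Fx : F @ x^'+ --> F x.
  apply: fine_cvg; rewrite rcdfE; exact: cdf_right_continuous.
apply: (cvgr_to_ge Fx); near=> y; apply: vF.
by near: y; exact: nbhs_right_gt.
Unshelve. all: by end_near. Qed.

Lemma exists_rcdf_gt v : v < 1 -> exists y, v < F y.
Proof.
move=> v1; have F1 : F @ +oo --> (1 : R) by exact/fine_cvg/cvg_cdfy1.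
have [N [_ HN]] := cvgr_gt _ F1 _ v1.
by exists (N + 1); apply: HN; rewrite ltrDl.
Qed.

Lemma rcdf_locally_constant x : ~ rv_support X x ->
  exists2 e, 0 < e & forall y z, x - e < y -> y <= z -> z < x + e -> F y = F z.
Proof.
move=> /existsNP[e /not_implyP[e0 /negP]]; rewrite -leNgt => Pe.
exists e => // y z xy yz zx; rewrite (rcdf_itvoc yz).
rewrite [X in fine X](_ : _ = 0%E) ?addr0//.
apply/eqP; rewrite -measure_le0; apply: le_trans Pe.
apply: le_measure; rewrite ?inE//; first exact: measurable_ball.
by move=> t /=; rewrite in_itv/= -ball_normE/= ltr_norml; lra.
Qed.

(** If [F a' < 1] for some [a' > a], the plateau of [F] starting at [a'] is bounded, because [F]
    tends to 1. Its supremum is off the support, so [F] is constant around it and the plateau would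
    extend further. Right continuity then passes from all [a' > a] to [a], which may itself lie in
    the support. *)
Lemma rcdf_eq1 a : (forall x, a < x -> ~ rv_support X x) -> F a = 1.
Proof.
move=> aS; have F1 x : F x <= 1 by case: rcdf_cdf_like => _ /(_ x)/andP[].
apply/eqP; rewrite eq_le F1/=; apply: ler_rcdf_right => a' aa'.
rewrite leNgt; apply/negP => /exists_rcdf_gt[y0 Fy0].
pose S := [set t | a' <= t /\ F t = F a'].
have Sa' : S a' by split.
have supS : has_sup S.
  split; first by exists a'.
  exists y0 => t [_ Ft]; rewrite leNgt; apply/negP => /ltW /rcdf_le.
  by rewrite Ft leNgt Fy0.
have a's : a' <= sup S by apply: sup_upper_bound.
have [e e0 cst] := rcdf_locally_constant (aS _ (lt_le_trans aa' a's)).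
have [t [a't Ft] st] := sup_adherent e0 supS.
have ts : t <= sup S by apply: sup_upper_bound.
have : S (sup S + e / 2).
  by split; [lra|rewrite -Ft; apply/esym/cst; lra].
move=> /(sup_upper_bound supS); lra.
Qed.

Lemma rcdf_lt1 x t : rv_support X t -> x < t -> F x < 1.
Proof.
move=> tS xt; have F1 : F x <= 1 by case: rcdf_cdf_like => _ /(_ x)/andP[].
rewrite lt_neqAle F1 andbT; apply/eqP => Fx.
have ccdf0 : ccdf X x = 0%E by rewrite ccdf_1_cdf -rcdfE Fx subee.
have xt0 : 0 < t - x by rewrite subr_gt0.
have := tS _ xt0; apply/negP; rewrite -leNgt -ccdf0.
apply: le_measure; rewrite ?inE//; first exact: measurable_ball.
by move=> y /=; rewrite in_itv/= -ball_normE/= ltr_norml andbT; lra.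
Qed.

Context (X_ge0 : {ae P, forall t, 0 <= X t}).

Lemma rcdf_lt0 x : x < 0 -> F x = 0.
Proof.
move=> x0; apply: EFin_inj; rewrite rcdfE.
apply: (measure_negligible (mu := P)) => //.
  by rewrite -[X in measurable X]setTI; exact: measurable_funP.
apply: negligibleS X_ge0 => t /=; rewrite in_itv/= => Xt /=; lra.
Qed.

Context (X_bounded : bounded_set (rv_support X)).
Local Notation b := (right_endpoint X).

Lemma has_sup_rv_support : has_sup (rv_support X).
Proof.
split.
  (* An empty support would give [F (-1) = 1], whereas nonnegativity gives 0. *)
  apply: contrapT => /forallNP S0; have := rcdf_lt0 (ltrN10 R).
  by rewrite rcdf_eq1// => /eqP; rewrite oner_eq0.
have [M [_ HM]] := X_bounded; exists (M + 1) => x Sx.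
by rewrite (le_trans (ler_norm _))// (HM (M + 1))// ltrDl.
Qed.

Lemma rcdf_ge1 x : (1 <= F x) = (b <= x).
Proof.
apply/idP/idP => [Fx|bx].
  apply: ge_sup; first by case: has_sup_rv_support.
  move=> t tS; rewrite leNgt; apply/negP => /(rcdf_lt1 tS).
  by rewrite ltNge Fx.
rewrite rcdf_eq1// => y xy /(sup_upper_bound has_sup_rv_support).
by rewrite -/b; lra.
Qed.

(** The Galois connection between quantile and distribution function: right continuity makes the
    infimum attained. The level set contains [b] because [v <= 1], and is bounded below by 0 because
    [v > 0]. *)
Lemma quantile_le v x : 0 < v -> v <= 1 -> (quantile X v <= x) = (v <= F x).
Proof.
move=> v0 v1; pose A := [set y | v <= F y].
have Anneg y : A y -> 0 <= y.
  move=> Ay; rewrite leNgt; apply/negP => /rcdf_lt0 Fy.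
  by move: Ay; rewrite /A/= Fy; lra.
have infA : has_inf A.
  by split; [exists b; rewrite /A/= (le_trans v1)// rcdf_ge1|exists 0].
apply/idP/idP => [qx|vx]; last by apply: inf_lbound => //; case: infA.
apply: le_trans (rcdf_le qx); apply: ler_rcdf_right => y.
rewrite -subr_gt0 => /inf_adherent/(_ infA)[z Az].
rewrite addrC subrK => /ltW zy.
exact: le_trans Az (rcdf_le zy).
Qed.

Lemma quantile_ge0_le v : 0 < v -> v <= 1 -> 0 <= quantile X v <= b.
Proof.
move=> v0 v1; apply/andP; split; last first.
  by rewrite quantile_le// (le_trans v1)// rcdf_ge1.
rewrite leNgt; apply/negP => /rcdf_lt0 Fq.
have := lexx (quantile X v); rewrite quantile_le// Fq; lra.
Qed.

End rcdf_theory.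

(** * Translation of the integrals *)

Lemma ge0_integral_shift (R : realType) (d : R) (f : R -> \bar R) (D : set R) :
  measurable D -> measurable_fun D f -> (forall x, 0 <= f x)%E ->
  (\int[lebesgue_measure]_(x in D) f x =
   \int[lebesgue_measure]_(x in (fun x : R => (x + d)%R) @^-1` D)
     f (x + d)%R)%E.
Proof.
move=> mD mf f0.
pose phi (x : measurableTypeR R) : measurableTypeR R := (x : R) + d.
have mphi : measurable_fun setT phi by exact: measurable_funD.
have f0' : {in D, forall x, (0 <= f x)%E} by move=> x _; exact: f0.
have := ge0_integral_pushforward mphi lebesgue_measure mD mf f0'.
move=> /= <-.
(* The image of Lebesgue measure under the translation agrees with it on the intervals []a, b]],
   hence everywhere. *)
apply: eq_measure_integral => // A mA _; apply: lebesgue_measure_unique => //.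
move=> _ [[a b] _ <-] /=; rewrite /pushforward.
rewrite (_ : phi @^-1` `]a, b] = `]a - d, b - d]%classic); last first.
  by apply/seteqP; split=> x /=; rewrite /phi !in_itv/=; lra.
by rewrite !lebesgue_measure_itv/= !lte_fin ltrD2r -!EFinB opprB addrA subrK.
Qed.

(** The substitution turns the domain into [[- d, b]]. Where this differs from [[0, b]], [F] is 0,
    and so is the integrand since [p.[0] = 0]. *)
Lemma integral_horner_shift (R : realType) (F : R -> R) (b d : R)
    (p : {poly R}) :
  cdf_like F -> (forall x, 0 <= x <= 1 -> 0 <= p.[x]) -> p.[0] = 0 ->
  (forall x, x < 0 -> F x = 0) -> (forall x, x < - d -> F x = 0) ->
  integral_horner (fun x => F (x - d)) (b + d) p = integral_horner F b p.
Proof.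
move=> cdfF p0 pz F0 Fd; rewrite /integral_horner.
have F01 : forall x, 0 <= F x <= 1 by case: cdfF.
have mG : measurable_fun `[0, b + d] (EFin \o (fun x => p.[F (x - d)])).
  have cdfG : cdf_like (fun x => F (x - d)).
    by case: cdfF => ndF _; split=> // x y xy; apply: ndF; rewrite lerB.
  apply: (measurable_int lebesgue_measure).
  by apply: (integrable_horner _ cdfG) => //; exact: lebesgue_measure_itv_lty.
rewrite /Rintegral (ge0_integral_shift d _ mG) => [|//|x]; last first.
  by rewrite lee_fin p0.
rewrite (_ : _ @^-1` _ = `[- d, b]%classic); last first.
  by apply/seteqP; split=> x /=; rewrite !in_itv/=; lra.
transitivity (\int[lebesgue_measure]_(x in `[- d, b]) p.[F x]).
  by congr fine; apply: eq_integral => x _ /=; rewrite addrK.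
rewrite -[RHS]/(\int[lebesgue_measure]_(x in `[0, b]) p.[F x]).
rewrite Rintegral_mkcond [RHS]Rintegral_mkcond.
apply: eq_Rintegral => x _ /=; rewrite !patchE !mem_setE/= !in_itv/=.
have [x0|x0] := ltP x 0; first by rewrite F0// pz !if_same.
by have [xd|//] := ltP x (- d); rewrite Fd// pz !if_same.
Qed.

(** * Passing between integrals and quantiles *)

Section quantiles_of_integrals.
Context (R : realType)
  (d1 : measure_display) (T1 : measurableType d1) (P1 : probability T1 R)
  (X : {RV P1 >-> R})
  (d2 : measure_display) (T2 : measurableType d2) (P2 : probability T2 R)
  (Y : {RV P2 >-> R}).
Context (X_ge0 : {ae P1, forall t, 0 <= X t})
  (Y_ge0 : {ae P2, forall t, 0 <= Y t})
  (X_bounded : bounded_set (rv_support X))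
  (Y_bounded : bounded_set (rv_support Y)).
Local Notation bX := (right_endpoint X).
Local Notation bY := (right_endpoint Y).

Lemma quantile_ge_of_integral_horner :
  (forall p, p.[0] = 0 ->
     integral_horner (rcdf X) bX p = integral_horner (rcdf Y) bY p) ->
  forall v, 0 < v -> v < 1 -> bX - quantile X v <= bY - quantile Y v.
Proof.
move=> XY v v0 v1; rewrite lerBrDr -lerBrDl opprB.
rewrite quantile_le// ?(ltW v1)// leNgt; apply/negP.
set x := (X in rcdf Y X) => Yx.
have /andP[Yx0 _] : 0 <= rcdf Y x <= 1 by case: (rcdf_cdf_like Y).
(* [level_set_le] needs two distinct levels. This [u] lies below [v], yet its [Y]-quantile still
   exceeds [x = bY - (bX - quantile X v)], which contradicts the resulting inequality. *)
pose u := (rcdf Y x + v) / 2.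
have [u0 uv u1] : [/\ 0 < u, u < v & u <= 1] by split; rewrite /u; lra.
have := level_set_le (rcdf_cdf_like X) (rcdf_cdf_like Y) XY u0 uv (ltW v1)
  (quantile_ge0_le X_ge0 X_bounded v0 (ltW v1))
  (quantile_ge0_le Y_ge0 Y_bounded u0 u1).
have Xv y : quantile X v <= y -> v <= rcdf X y by rewrite quantile_le// ltW.
have Yu y : y < quantile Y u -> rcdf Y y <= u.
  by rewrite ltNge quantile_le// -ltNge => /ltW.
move=> /(_ Xv Yu); have : x < quantile Y u.
  by rewrite ltNge quantile_le// -ltNge /u; lra.
rewrite /x; lra.
Qed.

Lemma rcdf_shift s :
  (forall v, 0 < v -> v < 1 -> quantile X v = quantile Y v + s) ->
  rcdf X = (fun x => rcdf Y (x - s)).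
Proof.
move=> XY; apply/funext => x.
have /andP[X0 X1] : 0 <= rcdf X x <= 1 by case: (rcdf_cdf_like X).
have /andP[Y0 Y1] : 0 <= rcdf Y (x - s) <= 1 by case: (rcdf_cdf_like Y).
have E v : 0 < v -> v < 1 -> (v <= rcdf X x) = (v <= rcdf Y (x - s)).
  by move=> v0 v1; rewrite -!quantile_le ?XY// ?lerBrDr// ltW.
(* If the two values differed, their midpoint would be a level in ]0, 1[ reached by only one of
   them. *)
have := E ((rcdf X x + rcdf Y (x - s)) / 2).
case: (ltgtP (rcdf X x) (rcdf Y (x - s))) => // H.
  have -> : ((rcdf X x + rcdf Y (x - s)) / 2 <= rcdf X x) = false by lra.
  by move=> /(_ ltac:(lra) ltac:(lra))/esym/negbT; lra.
have -> : ((rcdf X x + rcdf Y (x - s)) / 2 <= rcdf X x) by lra.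
by move=> /(_ ltac:(lra) ltac:(lra))/esym; lra.
Qed.

(** By [rcdf_ge1], the right endpoint is the least point where the distribution function reaches
    1. *)
Lemma right_endpoint_shift s :
  rcdf X = (fun x => rcdf Y (x - s)) -> bX = bY + s.
Proof.
move=> XY; have E x : (bX <= x) = (bY + s <= x).
  by rewrite -rcdf_ge1// XY rcdf_ge1// lerBrDr.
by apply/eqP; rewrite eq_le E lexx -E lexx.
Qed.

End quantiles_of_integrals.

(** * From extropies to all polynomials, and the equivalence *)

Lemma cpex_maxE (R : realType) (d : measure_display) (T : measurableType d)
  (P : probability T R) (X : {RV P >-> R}) n :
  cpex_max X n =
  - (1 / 2) * integral_horner (rcdf X) (right_endpoint X) 'X^(2 * n).
Proof.
rewrite /cpex_max /integral_horner.
by under [in RHS]eq_Rintegral do rewrite hornerXn.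
Qed.

Lemma integral_horner_eq_of_moments (R : realType) (F G : R -> R) (bF bG : R)
  (l : nat -> nat) :
  cdf_like F -> cdf_like G -> 0 <= bF -> 0 <= bG ->
  (forall i j, (i < j)%N -> (l i < l j)%N) ->
  series (fun j => (l j)%:R^-1 : R) @ \oo --> +oo ->
  (forall j, integral_horner F bF 'X^(l j) = integral_horner G bG 'X^(l j)) ->
  forall p, p.[0] = 0 -> integral_horner F bF p = integral_horner G bG p.
Proof.
move=> cdfF cdfG bF0 bG0 lincr ldiv FG p p0.
pose phi0 p : R := integral_horner F bF p - integral_horner G bG p.
have phi_scalar : scalar phi0.
  by move=> c q r; rewrite /phi0 !integral_horner_scalar//; ring.
pose phi : {scalar {poly R}} :=
  HB.pack phi0 (GRing.isLinear.Build _ _ _ _ phi0 phi_scalar).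
(* The difference of the two integrals has sup-norm bound [bF + bG]. The monomials of positive
   degree span the polynomials vanishing at 0. *)
have phiX q : (0 < q)%N -> phi 'X^q = 0.
  apply: (@muntz_functional _ phi (bF + bG) l) => // [r M rM|j]; last first.
    by rewrite /phi/= /phi0 FG subrr.
  rewrite mulrDl /phi/= /phi0 (le_trans (ler_normB _ _))// lerD//;
    exact: normr_integral_horner.
apply/eqP; rewrite -subr_eq0 -/(phi0 p) -[phi0 p]/(phi p); apply/eqP.
rewrite -[p]coefK poly_def linear_sum big1// => -[i ilt] _.
rewrite linearZ/=; case: i {ilt} => [|i]; last first.
  by rewrite [X in _ * X]phiX// mulr0.
by rewrite -horner_coef0 p0 mul0r.
Qed.

Theorem theorem3p5 (R : realType)
  (d1 : measure_display) (T1 : measurableType d1) (P1 : probability T1 R)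
  (X : {RV P1 >-> R})
  (d2 : measure_display) (T2 : measurableType d2) (P2 : probability T2 R)
  (Y : {RV P2 >-> R})
  (X_ge0 : {ae P1, forall t, 0 <= X t})
  (Y_ge0 : {ae P2, forall t, 0 <= Y t})
  (X_abs_cont : distribution P1 X `<< lebesgue_measure)
  (Y_abs_cont : distribution P2 Y `<< lebesgue_measure)
  (X_bounded : bounded_set (rv_support X))
  (Y_bounded : bounded_set (rv_support Y))
  (n : nat -> nat)
  (n_incr : forall i j, (i < j)%N -> (n i < n j)%N)
  (n_gt0 : forall j, (0 < n j)%N)
  (n_div : series (fun j => (n j)%:R^-1 : R) @ \oo --> +oo) :
  (exists d : R, forall v : R, 0 < v -> v < 1 ->
     quantile X v = quantile Y v + d) <->
  (forall j, cpex_max X (n j) = cpex_max Y (n j)).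
Proof.
split=> [[s XY] j|XY].
  have FG := rcdf_shift X_ge0 Y_ge0 X_bounded Y_bounded XY.
  have bXY := right_endpoint_shift X_ge0 Y_ge0 X_bounded Y_bounded FG.
  rewrite !cpex_maxE bXY FG integral_horner_shift//.
  - exact: rcdf_cdf_like.
  - by move=> x /andP[x0 _]; rewrite hornerXn exprn_ge0.
  - by rewrite hornerXn expr0n muln_eq0 (gtn_eqF (n_gt0 j)).
  - exact: rcdf_lt0.
  (* Below [- s], [rcdf Y] vanishes because it is a translate of [rcdf X], which vanishes below
     0. *)
  - move=> x xs; have := rcdf_lt0 X_ge0 (_ : x + s < 0).
    by rewrite FG addrK; apply; lra.
have b_ge0 d (T : measurableType d) (P : probability T R) (Z : {RV P >-> R}) :
    {ae P, forall t, 0 <= Z t} -> bounded_set (rv_support Z) ->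
    0 <= right_endpoint Z.
  move=> Z0 Zb; case/andP: (quantile_ge0_le Z0 Zb ltr01 (lexx _)).
  exact: le_trans.
have FG := @integral_horner_eq_of_moments R (rcdf X) (rcdf Y) (right_endpoint X)
  (right_endpoint Y) (fun j => 2 * n j)%N (rcdf_cdf_like X) (rcdf_cdf_like Y)
  (b_ge0 _ _ _ _ X_ge0 X_bounded) (b_ge0 _ _ _ _ Y_ge0 Y_bounded).
have {}FG : forall p, p.[0] = 0 ->
    integral_horner (rcdf X) (right_endpoint X) p =
    integral_horner (rcdf Y) (right_endpoint Y) p.
  apply: FG => [i j ij||j].
  - by rewrite ltn_pmul2l// n_incr.
  (* Doubling the exponents halves the partial sums, hence the threshold [2 * A]. *)
  - apply/cvgryPge => A; have /cvgryPge/(_ (2 * A)) := n_div.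
    apply: filterS => k; rewrite /series/=.
    under [in X in _ -> X]eq_bigr do rewrite natrM invfM.
    by rewrite -mulr_sumr => H; lra.
  - have := XY j; rewrite !cpex_maxE; apply: mulfI.
    by rewrite oppr_eq0 mul1r invr_eq0 pnatr_eq0.
(* The hypotheses are symmetric in [X] and [Y], so both inequalities between [bX - quantile X v] and
   [bY - quantile Y v] hold. *)
exists (right_endpoint X - right_endpoint Y) => v v0 v1.
have H1 := quantile_ge_of_integral_horner X_ge0 Y_ge0 X_bounded Y_bounded
  FG v0 v1.
have H2 := quantile_ge_of_integral_horner Y_ge0 X_ge0 Y_bounded X_bounded
  (fun p p0 => esym (FG p p0)) v0 v1.
by apply/eqP; rewrite eq_le; apply/andP; split; lra.
Qed.
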